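(* Let $P,Q\in\mathcal{B}(\mathcal{H})^{Id}$. Then: (i) $P\vee_{\preceq}Q$ exists and $P\vee_{\preceq}Q\neq I$ if and only if $N(P)\cap N(Q)\neq\{0\}$ and $(N(P)\cap N(Q))\dotplus\overline{R(P)+R(Q)}=\mathcal{H}$. In this case, $P\vee_{\preceq}Q$ is the idempotent operator onto $\overline{R(P)+R(Q)}$ along $N(P)\cap N(Q)$. (ii) $P\wedge_{\preceq}Q$ exists and $P\wedge_{\preceq}Q\neq 0$ if and only if $R(P)\cap R(Q)\neq\{0\}$ and $(R(P)\cap R(Q))\dotplus\overline{N(P)+N(Q)}=\mathcal{H}$. In this case, $P\wedge_{\preceq}Q$ is the idempotent operator onto $R(P)\cap R(Q)$ along $\overline{N(P)+N(Q)}$.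
   Context: $\mathcal{H}$ is a separable complex Hilbert space; $\mathcal{B}(\mathcal{H})^{Id}$ is the set of all bounded idempotent operators ($P^2=P$, not necessarily self-adjoint) on $\mathcal{H}$. $N(T)$ and $R(T)$ denote the null space and range of $T$; a bar denotes norm closure; $\mathcal{M}+\mathcal{N}$ is the linear span of the two subspaces, and $\mathcal{M}\dotplus\mathcal{N}$ denotes $\mathcal{M}+\mathcal{N}$ when $\mathcal{M}\cap\mathcal{N}=\{0\}$ (so writing $\mathcal{M}\dotplus\mathcal{N}=\mathcal{H}$ asserts both $\mathcal{M}\cap\mathcal{N}=\{0\}$ and $\mathcal{M}+\mathcal{N}=\mathcal{H}$). The idempotent onto $\mathcal{M}$ along $\mathcal{N}$ is the idempotent with range $\mathcal{M}$ and null space $\mathcal{N}$. For $P,Q\in\mathcal{B}(\mathcal{H})^{Id}$ write $P\preceq Q$ if $PQ=QP=P$; this is a partial order on $\mathcal{B}(\mathcal{H})^{Id}$. $P\vee_{\preceq}Q$ (respectively $P\wedge_{\preceq}Q$) denotes the least upper bound (respectively greatest lower bound) of $P$ and $Q$ in $(\mathcal{B}(\mathcal{H})^{Id},\preceq)$, if it exists. *)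

(* Defs.v *)
From HB Require Import structures.
From mathcomp Require Import all_boot all_order all_algebra.
From mathcomp Require Import all_classical all_reals all_analysis.
From mathcomp Require Import complex.

Set Implicit Arguments.
Unset Strict Implicit.
Unset Printing Implicit Defensive.

Import Order.TTheory GRing.Theory Num.Theory.
Import numFieldNormedType.Exports.

Local Open Scope classical_set_scope.
Local Open Scope ring_scope.

HB.mixin Record CompleteNormedModule_hasInner (R : realType) H
    of CompleteNormedModule R[i] H := {
  inner : {dot H for (@Num.conj R[i])} ;
  inner_normE : forall x : H, `|x| ^+ 2 = inner x x
}.

#[short(type="hilbertType")]
HB.structure Definition Hilbert (R : realType) :=
  {H of CompleteNormedModule R[i] H & CompleteNormedModule_hasInner R H}.

Definition separable (T : topologicalType) : Prop :=
  exists2 D : set T, countable D & dense D.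

(* For linear maps, [bounded_near _ (nbhs 0)] is boundedness on bounded sets
   ([bounded_funP]), equivalently continuity ([linear_bounded_continuous]). *)
Record bounded_idem (R : realType) (H : hilbertType R) := BoundedIdem {
  bidem_fun :> {linear H -> H} ;
  bidem_bounded : bounded_near bidem_fun (nbhs (0 : H)) ;
  bidem_idem : bidem_fun \o bidem_fun = bidem_fun :> (H -> H)
}.

Notation "''B' ( H )^Id" := (bounded_idem H) (format "''B' ( H )^Id").

HB.instance Definition _ (R : realType) (H : hilbertType R) :=
  gen_eqMixin 'B(H)^Id.
HB.instance Definition _ (R : realType) (H : hilbertType R) :=
  gen_choiceMixin 'B(H)^Id.

Section BoundedIdem.
Variables (R : realType) (H : hilbertType R).
Implicit Types (P Q E : 'B(H)^Id) (M N : set H).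

Lemma bidemP P Q : (P : H -> H) =1 Q -> P = Q.
Proof.
move=> /funext; case: P Q => [[f cf] bf If] [[g cg] bg Ig] /= fg; subst g.
have ecg : cg = cf.
  case: cg cf {bf If bg Ig} => [[a1] [s1]] [[a2] [s2]].
  by rewrite (Prop_irrelevance a1 a2) (Prop_irrelevance s1 s2).
by subst cg; congr BoundedIdem; exact: Prop_irrelevance.
Qed.

Definition bidem_le P Q : bool :=
  `[< P \o Q = P :> (H -> H) /\ Q \o P = P :> (H -> H) >].

Lemma bidem_le_refl : reflexive bidem_le.
Proof. by move=> P; apply/asboolP; split; exact: bidem_idem. Qed.

Lemma bidem_le_anti : antisymmetric bidem_le.
Proof.
move=> P Q /andP[/asboolP[_ QP] /asboolP[QP' _]]; apply: bidemP => x.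
by rewrite -QP QP'.
Qed.

Lemma bidem_le_trans : transitive bidem_le.
Proof.
move=> Q P E /asboolP[PQ QP] /asboolP[QE EQ]; apply/asboolP; split.
  by rewrite -{1}PQ -compA QE.
by rewrite -{1}QP compA EQ.
Qed.

Lemma bidem0_bounded : bounded_near (\0 : H -> H) (nbhs (0 : H)).
Proof. by apply/linear_bounded_continuous; exact: cst_continuous. Qed.

Lemma bidem1_bounded : bounded_near (idfun : H -> H) (nbhs (0 : H)).
Proof. by apply/linear_bounded_continuous => x; exact: cvg_id. Qed.

Definition bidem0 : 'B(H)^Id :=
  @BoundedIdem R H \0 bidem0_bounded erefl.

Definition bidem1 : 'B(H)^Id :=
  @BoundedIdem R H idfun bidem1_bounded erefl.

Definition nullspace P : set H := [set x | P x = 0].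

(* For subspaces [M] and [N] this is the linear span of their union. *)
Definition sumset M N : set H := [set x + y | x in M & y in N].

(* [H] is the (algebraic) direct sum of [M] and [N]. *)
Definition direct_decomp M N : Prop :=
  M `&` N = [set 0] /\ sumset M N = [set: H].

Definition idem_onto_along E M N : Prop := range E = M /\ nullspace E = N.

End BoundedIdem.

Fact bidem_display : Order.disp_t. Proof. exact: Order.Disp tt tt. Qed.

HB.instance Definition _ (R : realType) (H : hilbertType R) :=
  Order.Le_isPOrder.Build bidem_display 'B(H)^Id
    (@bidem_le_refl R H) (@bidem_le_anti R H) (@bidem_le_trans R H).

(* Main.v *)
(* The least upper bound E of P and Q is compared with the upper bounds
   x |-> x - (<x, v> / <y, v>) y, where y ranges over N(P) /\ N(Q) and v over the
   orthogonal complement of S = R(P) + R(Q), with <y, v> <> 0: minimality of E puts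
   y in N(E) and v in the orthogonal complement of R(E).  If E <> I, one such pair
   (y0, v0) exists with y0 in N(E); translating y by y0 and v by v0 removes the
   condition <y, v> <> 0, so that N(E) = N(P) /\ N(Q), and R(E) = closure S by the
   double orthogonal theorem.  Conversely, the algebraic projection attached to a
   decomposition of H into closed subspaces is bounded, and it is the least upper
   bound.  Part (ii) is part (i) for I - P and I - Q. *)
From HB Require Import structures.
Require Import Defs.
From mathcomp Require Import all_boot all_order all_algebra.
From mathcomp Require Import all_classical all_reals all_analysis.
From mathcomp Require Import complex.
From mathcomp Require Import ring lra.

Set Implicit Arguments.
Unset Strict Implicit.
Unset Printing Implicit Defensive.

Import Order.TTheory GRing.Theory Num.Theory.
Import numFieldNormedType.Exports.

Local Open Scope classical_set_scope.
Local Open Scope ring_scope.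

Section HilbertGeometry.
Variables (R : realType) (H : hilbertType R).
Implicit Types (x y z : H) (a : R[i]) (r e : R).

(** * Real-valued norm and inner product *)

(** The norm of [H] takes values in [R[i]], whose order is only partial; its real part moves every
    estimate to the ordered field [R]. *)
Definition rnorm x : R := complex.Re `|x|.

Definition rdot x y : R := complex.Re (inner x y).

Lemma rnormE x : `|x| = (rnorm x)%:C%C.
Proof. by rewrite /rnorm RRe_real ?normr_real. Qed.

Lemma rnorm_ge0 x : 0 <= rnorm x.
Proof. by rewrite -(lecR 0) -rnormE normr_ge0. Qed.

Lemma rnorm_eq0 x : rnorm x = 0 -> x = 0.
Proof. by move=> x0; apply/eqP; rewrite -normr_eq0 rnormE x0. Qed.

Lemma rnorm0 : rnorm 0 = 0.
Proof. by rewrite /rnorm normr0. Qed.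

Lemma rnormN x : rnorm (- x) = rnorm x.
Proof. by rewrite /rnorm normrN. Qed.

Lemma rnorm_sub x y : rnorm (x - y) = rnorm (y - x).
Proof. by rewrite -rnormN opprB. Qed.

Lemma ler_rnormD x y : rnorm (x + y) <= rnorm x + rnorm y.
Proof. by rewrite -lecR rmorphD /= -!rnormE ler_normD. Qed.

Lemma rnormZ a x : rnorm (a *: x) = complex.Re `|a| * rnorm x.
Proof. by rewrite /rnorm normrZ !normc_def /= rnormE /= mul0r subr0. Qed.

Lemma rnormZr r x : rnorm (r%:C%C *: x) = `|r| * rnorm x.
Proof. by rewrite rnormZ normc_def /= expr0n /= addr0 sqrtr_sqr. Qed.

Lemma innerDl x y z : inner (x + y) z = inner x z + inner y z.
Proof. exact: linearDl. Qed.

Lemma innerDr z x y : inner z (x + y) = inner z x + inner z y.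
Proof. exact: linearDr. Qed.

Lemma innerZl a x z : inner (a *: x) z = a * inner x z.
Proof. exact: linearZl_LR. Qed.

Lemma innerZr a z x : inner z (a *: x) = (a^*)%C * inner z x.
Proof. exact: linearZr_LR. Qed.

Lemma innerC x y : inner x y = ((inner y x)^*)%C.
Proof. by rewrite hermC expr0 mul1r. Qed.

Lemma innerBl x y z : inner (x - y) z = inner x z - inner y z.
Proof. exact: linearBl. Qed.

Lemma inner0l z : inner 0 z = 0.
Proof. exact: linear0l. Qed.

Lemma inner0r z : inner z 0 = 0.
Proof. exact: linear0r. Qed.

Lemma rdotC x y : rdot x y = rdot y x.
Proof. by rewrite /rdot innerC; case: (inner y x). Qed.

Lemma rdotDl x y z : rdot (x + y) z = rdot x z + rdot y z.
Proof. by rewrite /rdot innerDl; case: (inner x z); case: (inner y z). Qed.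

Lemma rdotZl r x z : rdot (r%:C%C *: x) z = r * rdot x z.
Proof. by rewrite /rdot innerZl; case: (inner x z) => u v /=; rewrite mul0r subr0. Qed.

Lemma rdotNl x z : rdot (- x) z = - rdot x z.
Proof. by rewrite -scaleN1r -(rmorphN1 (real_complex R)) rdotZl mulN1r. Qed.

Lemma rdotBl x y z : rdot (x - y) z = rdot x z - rdot y z.
Proof. by rewrite rdotDl rdotNl. Qed.

Lemma rdotDr z x y : rdot z (x + y) = rdot z x + rdot z y.
Proof. by rewrite rdotC rdotDl !(rdotC z). Qed.

Lemma rdotBr z x y : rdot z (x - y) = rdot z x - rdot z y.
Proof. by rewrite rdotC rdotBl !(rdotC z). Qed.

Lemma rdotZr r z x : rdot z (r%:C%C *: x) = r * rdot z x.
Proof. by rewrite rdotC rdotZl rdotC. Qed.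

Lemma rdotxx x : rdot x x = rnorm x ^+ 2.
Proof. by rewrite /rdot -inner_normE rnormE -rmorphXn. Qed.

Lemma rnormD_sqr x y :
  rnorm (x + y) ^+ 2 = rnorm x ^+ 2 + 2 * rdot x y + rnorm y ^+ 2.
Proof. by rewrite -!rdotxx rdotDl !rdotDr (rdotC y x); ring. Qed.

Lemma rnormB_sqr x y :
  rnorm (x - y) ^+ 2 = rnorm x ^+ 2 - 2 * rdot x y + rnorm y ^+ 2.
Proof. by rewrite -!rdotxx rdotBl !rdotBr (rdotC y x); ring. Qed.

(** Multiplication by ['i] turns imaginary parts into real ones, so orthogonality to a complex
    subspace can be tested with [rdot] alone. *)
Lemma inner_rdot x y : inner x y = (rdot x y +i* - rdot ('i%C *: x) y)%C.
Proof.
by rewrite /rdot innerZl; case: (inner x y) => u v /=; rewrite mul0r mul1r sub0r opprK.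
Qed.

(** Subtracting from [x] the optimal multiple [rdot x y / rnorm y ^+ 2] of [y] leaves a vector of
    nonnegative squared norm; clearing the denominator gives the inequality. *)
Lemma cauchy_schwarz x y : `|rdot x y| <= rnorm x * rnorm y.
Proof.
have [->|y0] := eqVneq y 0.
  by rewrite /rdot inner0r rnorm0 mulr0 normr0.
have ny : 0 < rnorm y.
  by rewrite lt_def rnorm_ge0 andbT; apply: contra_neq y0; exact: rnorm_eq0.
rewrite -(@ler_pXn2r _ 2) ?nnegrE ?mulr_ge0 ?rnorm_ge0 //.
rewrite real_normK ?num_real // exprMn.
have := sqr_ge0 (rnorm (x - (rdot x y / rnorm y ^+ 2)%:C%C *: y)).
rewrite rnormB_sqr rdotZr rnormZr exprMn real_normK ?num_real //.
have ny2 : 0 < rnorm y ^+ 2 by rewrite exprn_gt0.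
move=> h; rewrite -subr_ge0.
rewrite [X in 0 <= X](_ : _ = rnorm y ^+ 2 * (rnorm x ^+ 2 -
  2 * (rdot x y / rnorm y ^+ 2 * rdot x y) +
  (rdot x y / rnorm y ^+ 2) ^+ 2 * rnorm y ^+ 2)); last first.
  by field; rewrite gt_eqF.
by rewrite mulr_ge0 // ltW.
Qed.

Lemma rdot_le x y : rdot x y <= rnorm x * rnorm y.
Proof. exact: le_trans (ler_norm _) (cauchy_schwarz x y). Qed.

Lemma inner_bound v : exists C : R,
  forall x, complex.Re `|inner x v| <= C * rnorm x.
Proof.
exists (rnorm v) => x.
have n0 : 0 <= complex.Re `|inner x v|.
  by rewrite -(lecR 0) RRe_real ?normr_real ?normr_ge0.
have [->|nz] := eqVneq (complex.Re `|inner x v|) 0.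
  by rewrite mulr_ge0 ?rnorm_ge0.
have n1 : 0 < complex.Re `|inner x v| by rewrite lt_def nz.
(* The left side is the squared modulus of [inner x v], and one factor cancels. *)
have := rdot_le x (inner x v *: v).
rewrite rnormZ {1}/rdot innerZr mulrC -sqr_normc.
have -> : complex.Re (`|inner x v| ^+ 2) = complex.Re `|inner x v| ^+ 2.
  by rewrite normc_def -rmorphXn.
by move=> h; rewrite -(ler_pM2l n1); lra.
Qed.

(** * Closure and completeness in terms of [rnorm] *)

Lemma closure_rnormP (A : set H) x :
  closure A x <-> forall e, 0 < e -> exists2 y, A y & rnorm (x - y) < e.
Proof.
split=> [clA e e0|h B /nbhs_ballP[d /= d0 dB]].
  have /clA[y [Ay]] : nbhs x (ball x (e%:C)%C).
    by apply: nbhsx_ballx; rewrite (ltcR 0).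
  by rewrite -ball_normE /ball_ /= rnormE ltcR => ?; exists y.
have dE : d = (complex.Re d)%:C%C by rewrite RRe_real // gtr0_real.
have [|y Ay xy] := h (complex.Re d); first by rewrite -ltcR -dE.
exists y; split => //; apply: dB.
by rewrite -ball_normE /ball_ /= rnormE dE ltcR.
Qed.

(** Letting [k] tend to infinity turns the Cauchy estimate into an error bound at every index. *)
Lemma cauchy_modulus (u : nat -> H) (m : nat -> R) :
  (forall n k, (n <= k)%N -> rnorm (u n - u k) <= m n) ->
  (forall e, 0 < e -> exists n, m n < e) ->
  exists l, forall n, rnorm (u n - l) <= m n.
Proof.
move=> um m0.
have /cvg_ex[l ul] : cvg (u @ \oo).
  apply: cauchy_cvg; apply: cauchy_exP => d d0.
  have dE : d = (complex.Re d)%:C%C by rewrite RRe_real // gtr0_real.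
  have [|n mn] := m0 (complex.Re d); first by rewrite -ltcR -dE.
  exists (u n); exists n => // k /= nk.
  by rewrite -ball_normE /ball_ /= rnormE dE ltcR (le_lt_trans (um _ _ nk)).
exists l => n; apply/ler_addgt0Pl => e e0.
have /cvgrPdist_lt/(_ (e%:C)%C) : u @ \oo --> l by [].
rewrite (ltcR 0) => /(_ e0)[N _ hN].
have := hN (maxn N n) (leq_maxl _ _); rewrite /= rnormE ltcR => h.
have := um n (maxn N n) (leq_maxr _ _).
have -> : u n - l = (u n - u (maxn N n)) + (u (maxn N n) - l).
  by rewrite addrA subrK.
move=> h1; apply: le_trans (ler_rnormD _ _) _.
by rewrite addrC lerD // rnorm_sub ltW.
Qed.

(** * Subspaces, orthogonal complements and orthogonal projection *)

Definition subspace (A : set H) : Prop :=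
  A 0 /\ forall a x y, A x -> A y -> A (a *: x + y).

Definition orth (A : set H) : set H :=
  [set v | forall x, A x -> inner x v = 0].

Lemma subspaceD A x y : subspace A -> A x -> A y -> A (x + y).
Proof. by case=> _ h Ax Ay; rewrite -(scale1r x); exact: h. Qed.

Lemma subspaceZ A a x : subspace A -> A x -> A (a *: x).
Proof. by case=> A0 h Ax; rewrite -[_ *: _]addr0; exact: h. Qed.

Lemma subspaceB A x y : subspace A -> A x -> A y -> A (x - y).
Proof. by case=> _ h Ax Ay; rewrite addrC -scaleN1r; exact: h. Qed.

Lemma subspace_orth A : subspace (orth A).
Proof.
split=> [x _|a u v Au Av x Ax]; first exact: inner0r.
by rewrite innerDr innerZr Au // Av // mulr0 addr0.
Qed.

Lemma subspace_sumset A B : subspace A -> subspace B -> subspace (sumset A B).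
Proof.
move=> sA sB; split.
  by exists 0; [exact: sA.1|exists 0; [exact: sB.1|exact: addr0]].
move=> a _ _ [x Ax [y By <-]] [x' Ax' [y' By' <-]].
exists (a *: x + x'); first exact: sA.2.
by exists (a *: y + y'); [exact: sB.2|rewrite scalerDr addrACA].
Qed.

Lemma subspace_closure A : subspace A -> subspace (closure A).
Proof.
move=> sA; split=> [|a x y /closure_rnormP Ax /closure_rnormP Ay].
  by apply: subset_closure; exact: sA.1.
apply/closure_rnormP => e e0.
have k0 : 0 <= complex.Re `|a| by rewrite -(lecR 0) RRe_real ?normr_real ?normr_ge0.
have [|x' Ax' xx'] := Ax (e / (2 * (complex.Re `|a| + 1))).
  by rewrite divr_gt0 // mulr_gt0 // ltr_wpDl.
have [|y' Ay' yy'] := Ay (e / 2); first by rewrite divr_gt0.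
exists (a *: x' + y'); first exact: sA.2.
have -> : a *: x + y - (a *: x' + y') = a *: (x - x') + (y - y').
  by rewrite scalerBr opprD addrACA.
apply: le_lt_trans (ler_rnormD _ _) _; rewrite rnormZ.
rewrite [e]splitr ler_ltD //.
have k1 : 0 < complex.Re `|a| + 1 by rewrite ltr_wpDl.
have := ltW xx'; rewrite -(ler_pM2l k1).
rewrite [X in _ <= X -> _](_ : _ = e / 2); last by field; rewrite gt_eqF.
by apply: le_trans; rewrite ler_wpM2r ?rnorm_ge0 // lerDl.
Qed.

(* The vectors of the subspace [A] almost nearest to [x] are Cauchy by the
   parallelogram identity. *)
Lemma orthogonal_projection A x : subspace A ->
  exists2 p, closure A p & orth A (x - p).
Proof.
move=> sA; pose S := [set rnorm (x - d) ^+ 2 | d in A].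
have S0 d : A d -> inf S <= rnorm (x - d) ^+ 2.
  move=> Ad; apply: ge_inf; last by exists d.
  by exists 0 => _ [b _ <-]; rewrite sqr_ge0.
have hS : has_inf S.
  split; first by exists (rnorm (x - 0) ^+ 2), 0 => //; exact: sA.1.
  by exists 0 => _ [b _ <-]; rewrite sqr_ge0.
pose m n : R := n.+1%:R^-1.
have m_gt0 n : 0 < m n by rewrite invr_gt0.
(* With slack [m n ^+ 2 / 4], the parallelogram identity bounds [rnorm (u n - u k) ^+ 2] by the mean
   of [m n ^+ 2] and [m k ^+ 2]. *)
have /choice[u uP] n : exists d, A d /\ rnorm (x - d) ^+ 2 < inf S + m n ^+ 2 / 4.
  have [|_ [d Ad <-] ?] := @inf_adherent _ S (m n ^+ 2 / 4) _ hS; last by exists d.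
  by rewrite divr_gt0 // exprn_gt0.
have mle n k : (n <= k)%N -> m k <= m n.
  by move=> nk; rewrite lef_pV2 ?posrE // ler_nat.
have m0 e : 0 < e -> exists n, m n < e.
  move=> e0; exists (Num.truncn e^-1).
  by rewrite invf_plt ?posrE // truncnS_gt.
have [|//|p pu] := @cauchy_modulus u m.
  move=> n k nk; rewrite -(@ler_pXn2r _ 2) ?nnegrE ?rnorm_ge0 ?(ltW (m_gt0 _)) //.
  have Amid : A ((2^-1 : R)%:C%C *: (u n + u k)).
    by apply: subspaceZ => //; apply: subspaceD => //; have [] := uP n; have [] := uP k.
  have := S0 _ Amid; have [_] := uP n; have [_] := uP k.
  have -> : u n - u k = (x - u k) - (x - u n) by rewrite opprB addrCA addrAC subrr add0r addrC.
  have -> : x - (2^-1 : R)%:C%C *: (u n + u k) =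
            (2^-1 : R)%:C%C *: ((x - u k) + (x - u n)).
    rewrite addrACA -opprD (addrC (u k)) scalerBr; congr (_ - _).
    rewrite -mulr2n -[x *+ 2]scaler_nat scalerA -(rmorph_nat (real_complex R)) -rmorphM /=.
    by rewrite mulVf ?pnatr_eq0 // rmorph1 scale1r.
  rewrite rnormZr exprMn (rnormD_sqr (x - u k)) (rnormB_sqr (x - u k)) real_normK ?num_real //.
  have : m k ^+ 2 <= m n ^+ 2 by rewrite ler_pXn2r ?nnegrE ?(ltW (m_gt0 _)) // mle.
  by move=> h1 h2 h3 h4; lra.
have rp d : A d -> rdot d (x - p) = 0.
  move=> Ad; apply/eqP; rewrite -normr_eq0 eq_le normr_ge0 andbT.
  apply/ler_addgt0Pl => e e0; rewrite addr0.
  have [|n mn] := m0 (e / (2 * (rnorm d + 1))).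
    by rewrite divr_gt0 // mulr_gt0 // ltr_wpDl ?rnorm_ge0.
  have mn' : m n * rnorm d <= e / 2.
    have d1 : 0 < rnorm d + 1 by rewrite ltr_wpDl ?rnorm_ge0.
    have := ltW mn; rewrite -(ler_pM2r d1).
    rewrite [X in _ <= X -> _](_ : _ = e / 2); last by field; rewrite gt_eqF.
    by apply: le_trans; rewrite ler_wpM2l ?lerDl // ltW.
  have h1 : `|rdot d (u n - p)| <= m n * rnorm d.
    by rewrite (le_trans (cauchy_schwarz _ _)) // mulrC ler_wpM2r ?rnorm_ge0.
  have h2 : `|rdot d (x - u n)| <= m n * rnorm d.
    have [->|d0] := eqVneq d 0; first by rewrite /rdot inner0l normr0 rnorm0 mulr0.
    have nd : 0 < rnorm d.
      by rewrite lt_def rnorm_ge0 andbT; apply: contra_neq d0; exact: rnorm_eq0.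
    have nd2 : 0 < rnorm d ^+ 2 by rewrite exprn_gt0.
    rewrite -(@ler_pXn2r _ 2) ?nnegrE ?mulr_ge0 ?rnorm_ge0 ?(ltW (m_gt0 _)) //.
    rewrite real_normK ?num_real // exprMn -ler_pdivrMr //.
    (* Moving [u n] by the optimal multiple [t] of [d] lowers the squared distance to [x] by
       [rdot d (x - u n) ^+ 2 / rnorm d ^+ 2], which cannot exceed the slack above the infimum. *)
    pose t : R := rdot d (x - u n) / rnorm d ^+ 2.
    have [Au un] := uP n.
    have := S0 _ (subspaceD sA (subspaceZ (t%:C)%C sA Ad) Au).
    rewrite opprD addrCA addrC (rnormB_sqr (x - u n)) rdotZr (rdotC _ d) rnormZr exprMn.
    rewrite real_normK ?num_real //.
    have -> : t * rdot d (x - u n) = rdot d (x - u n) ^+ 2 / rnorm d ^+ 2.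
      by rewrite /t mulrAC -expr2.
    have -> : t ^+ 2 * rnorm d ^+ 2 = rdot d (x - u n) ^+ 2 / rnorm d ^+ 2.
      by rewrite /t; field; rewrite gt_eqF.
    have := sqr_ge0 (m n).
    by move: (rdot d (x - u n) ^+ 2 / rnorm d ^+ 2) => w; lra.
  have -> : x - p = (x - u n) + (u n - p) by rewrite addrA subrK.
  by rewrite rdotDr (le_trans (ler_normD _ _)) //; lra.
exists p.
  apply/closure_rnormP => e /m0[n mn]; exists (u n); first by have [] := uP n.
  by rewrite rnorm_sub (le_lt_trans (pu n)).
move=> d Ad; rewrite inner_rdot !rp ?oppr0 //.
exact: subspaceZ.
Qed.

(** The residual [x - p] of the projection is orthogonal to [x] by hypothesis and to [p] by
    approximating [p] from [A]; hence it is orthogonal to itself. *)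
Lemma closure_double_orth A x : subspace A ->
  (forall v, orth A v -> inner x v = 0) -> closure A x.
Proof.
move=> sA h; have [p Ap op] := orthogonal_projection x sA.
suff -> : x = p by [].
apply/eqP; rewrite -subr_eq0; apply/eqP/rnorm_eq0/eqP.
rewrite -sqrf_eq0 -rdotxx {1}rdotBl.
have -> : rdot x (x - p) = 0 by rewrite /rdot h.
rewrite sub0r oppr_eq0 -normr_eq0 eq_le normr_ge0 andbT.
apply/ler_addgt0Pl => e e0; rewrite addr0.
have k1 : 0 < rnorm (x - p) + 1 by rewrite ltr_wpDl ?rnorm_ge0.
have /closure_rnormP/(_ (e / (rnorm (x - p) + 1)))[|q Aq pq] := Ap.
  by rewrite divr_gt0.
rewrite -[p in rdot p _](subrK q) rdotDl [rdot q _]/rdot op // addr0.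
rewrite (le_trans (cauchy_schwarz _ _)) //.
move: pq; rewrite ltr_pdivlMr // => /ltW; apply: le_trans.
by rewrite ler_wpM2l ?rnorm_ge0 // lerDl.
Qed.

(** * Uniform boundedness and the bound for oblique projections *)

(* Uniform boundedness by a gliding hump: moving [x] by [w] and by [- w], where
   [w] is collinear to [b], changes [rdot x b] by [2 * rdot w b] overall, so one
   of the two moves makes it large. *)
Lemma uniform_bound (S : set H) :
  (forall x, exists C, forall b : H, S b -> `|rdot x b| <= C) ->
  exists C, forall b : H, S b -> rnorm b <= C.
Proof.
move=> ptwise; apply: contrapT => /forallNP unb.
(* Move [n] has size at most [c n] and all later moves total at most [c n / 2]. Half of the value
   [c n * rnorm (b n)] thus survives in the limit, and the choice of [b n] makes that half exceed
   [n]. *)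
pose c n : R := (3 ^ n)%:R^-1.
have c_gt0 n : 0 < c n by rewrite invr_gt0 ltr0n expn_gt0.
have cS n : c n = 3 * c n.+1.
  by rewrite /c expnS natrM invfM mulrA divff ?mul1r ?pnatr_eq0.
have /choice[b bP] n : exists b, S b /\ 2 * n%:R / c n < rnorm b.
  have /existsNP[b /not_implyP[Sb /negP]] := unb (2 * n%:R / c n).
  by rewrite -ltNge => bn; exists b.
have step (q : nat * H) : exists y, rnorm (y - q.2) <= c q.1 /\
    c q.1 * rnorm (b q.1) <= `|rdot y (b q.1)|.
  case: q => n x /=; have [Sb bn] := bP n.
  have nb : 0 < rnorm (b n).
    by rewrite (le_lt_trans _ bn) // divr_ge0 ?mulr_ge0 ?(ltW (c_gt0 _)).
  pose w := ((c n / rnorm (b n))%:C)%C *: b n.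
  have nw : rnorm w = c n.
    by rewrite rnormZr ger0_norm ?divr_ge0 ?divfK ?gt_eqF ?rnorm_ge0 ?(ltW (c_gt0 _)).
  have wb : rdot w (b n) = c n * rnorm (b n).
    by rewrite rdotZl rdotxx; field; rewrite gt_eqF.
  have [h|h] := lerP (c n * rnorm (b n)) (`|rdot (x + w) (b n)|).
    by exists (x + w); rewrite addrAC subrr add0r nw.
  exists (x - w); rewrite addrAC subrr add0r rnormN nw; split => //.
  move: h; rewrite rdotDl rdotBl wb.
  have := mulr_gt0 (c_gt0 n) nb; move: (c n * rnorm (b n)) (rdot x _) => p r p0.
  by rewrite ltr_norml ler_normr => /andP[h1 h2]; apply/orP; right; lra.
have [g gP] := choice step.
pose fix u n := if n is k.+1 then g (k, u k) else 0.
(* The sum of the steps telescopes, as [c j = 3 / 2 * (c j - c j.+1)]. *)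
have uc n k : rnorm (u n - u (n + k)%N) <= 3 / 2 * (c n - c (n + k)%N).
  elim: k => [|k IHk]; first by rewrite addn0 !subrr rnorm0 mulr0.
  rewrite addnS; have [+ _] := gP ((n + k)%N, u (n + k)%N).
  rewrite rnorm_sub /= => h.
  have := ler_rnormD (u n - u (n + k)%N) (u (n + k)%N - g ((n + k)%N, u (n + k)%N)).
  by rewrite addrA subrK; move: h IHk; rewrite (cS (n + k)%N); lra.
have [| |l ul] := @cauchy_modulus u (fun n => 3 / 2 * c n).
- move=> n k /subnKC <-; apply: le_trans (uc _ _) _.
  by rewrite ler_wpM2l // lerBlDr lerDl ltW.
- move=> e e0; exists (Num.truncn (3 / 2 / e)).
  set n := Num.truncn _.
  have : 3 / 2 / e < n.+1%:R by rewrite truncnS_gt.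
  rewrite ltr_pdivrMr // => h.
  have : 3 / 2 / n.+1%:R < e.
    by rewrite ltr_pdivrMr ?ltr0Sn // (mulrC e).
  apply: le_lt_trans; rewrite ler_wpM2l // /c lef_pV2 ?posrE ?ltr0n ?expn_gt0 //.
  by rewrite ler_nat ltn_expl.
have [C hC] := ptwise l.
pose n := (Num.truncn C).+1.
have nC : C < n%:R by rewrite truncnS_gt.
have [Sb bn] := bP n.
have := hC _ Sb; apply/negP; rewrite -ltNge (lt_le_trans nC) //.
have [_] := gP (n, u n); rewrite -[g _]/(u n.+1) /= => h1.
have h2 := cauchy_schwarz (u n.+1 - l) (b n).
have h3 : rnorm (u n.+1 - l) * rnorm (b n) <= c n / 2 * rnorm (b n).
  by rewrite ler_wpM2r ?rnorm_ge0 // (le_trans (ul _)) // (cS n); lra.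
move: bn; rewrite ltr_pdivrMr // (mulrC (rnorm _)) => h4.
have := ler_normD (rdot (u n.+1 - l) (b n)) (rdot l (b n)).
by rewrite -rdotDl subrK /=; lra.
Qed.

(* [M^perp + N^perp] is dense, and [|m|^2 = <m, b> = <m + n, b>] whenever
   [m = a + b] with [a] orthogonal to [M] and [b] to [N], while [b] is bounded by
   [a + b] by uniform boundedness. *)
Lemma oblique_bound (M N : set H) : subspace M -> subspace N ->
  closed M -> closed N -> direct_decomp M N ->
  exists C, forall x y, M x -> N y -> rnorm x <= C * rnorm (x + y).
Proof.
move=> sM sN cM cN [MN0 MNT].
(* Pointwise, [<m + n, b> = <m, a + b>] is at most [rnorm m] on [S]. *)
pose S := [set b | orth N b /\ exists2 a, orth M a & rnorm (a + b) <= 1].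
have [|C hC] := @uniform_bound S.
  move=> x; have : sumset M N x by rewrite MNT.
  case=> m Mm [n Nn <-]; exists (rnorm m) => b [Nb [a Ma ab]].
  have -> : rdot (m + n) b = rdot m (a + b).
    by rewrite rdotDl rdotDr /rdot (Nb _ Nn) (Ma _ Mm) /= addr0 add0r.
  by rewrite (le_trans (cauchy_schwarz _ _)) // ler_piMr ?rnorm_ge0.
have C0 : 0 <= C.
  rewrite -rnorm0; apply: hC; split; first exact: (subspace_orth N).1.
  by exists 0; [exact: (subspace_orth M).1|rewrite addr0 rnorm0 ler01].
have hb (a b : H) : orth M a -> orth N b -> rnorm b <= C * rnorm (a + b).
  move=> Ma Nb; have [ab0|ab0] := eqVneq (rnorm (a + b)) 0.
    suff : rnorm b ^+ 2 == 0 by rewrite sqrf_eq0 ab0 mulr0 => /eqP ->.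
    rewrite -rdotxx.
    (* When [a + b = 0], [b] is orthogonal to both [M] and [N], hence to all of [H]. *)
    have Mb : orth M b.
      rewrite -[b](addKr a) (rnorm_eq0 ab0) addr0 -sub0r.
      by apply: subspaceB Ma; [exact: subspace_orth|exact: (subspace_orth M).1].
    have : sumset M N b by rewrite MNT.
    case=> m Mm [n Nn mnb]; rewrite -{1}mnb rdotDl /rdot.
    by rewrite (Mb _ Mm) (Nb _ Nn) addr0.
  have nab : 0 < rnorm (a + b) by rewrite lt_def ab0 rnorm_ge0.
  pose k := ((rnorm (a + b))^-1%:C)%C.
  have := hC (k *: b); rewrite rnormZr ger0_norm ?invr_ge0 ?rnorm_ge0 //.
  rewrite mulrC ler_pdivrMr //; apply; split.
    exact: subspaceZ (subspace_orth N) Nb.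
  exists (k *: a); first exact: subspaceZ (subspace_orth M) Ma.
  by rewrite -scalerDr rnormZr ger0_norm ?invr_ge0 ?rnorm_ge0 // mulVf.
(* A vector orthogonal to both complements lies in [M] and in [N], since both are closed, and so
   vanishes. *)
have dense x : closure (sumset (orth M) (orth N)) x.
  apply: closure_double_orth.
    by apply: subspace_sumset; exact: subspace_orth.
  move=> v ov; have : (M `&` N) v.
    split; [apply: cM|apply: cN]; apply: closure_double_orth => // w ow.
    - rewrite innerC ov ?conjc0 //; exists w => //.
      by exists 0; [exact: (subspace_orth N).1|rewrite addr0].
    - rewrite innerC ov ?conjc0 //; exists 0; first exact: (subspace_orth M).1.
      by exists w => //; rewrite add0r.
  by rewrite MN0 => ->; exact: inner0r.
exists C => m n Mm Nn; rewrite leNgt; apply/negP => lt_m.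
set K := C * rnorm (m + n) in lt_m.
have K0 : 0 <= K by rewrite mulr_ge0 ?rnorm_ge0.
have m0 : 0 < rnorm m by exact: le_lt_trans lt_m.
have mK : 0 < rnorm m + K by rewrite ltr_pwDl.
(* The estimates below yield [(rnorm m - K) * rnorm m <= e * (rnorm m + K)]; this [e] makes the
   right side half of the positive left side. *)
pose e := (rnorm m - K) * rnorm m / (2 * (rnorm m + K)).
have /closure_rnormP/(_ e)[|_ [a Ma [b Nb <-]] me] := dense m.
  by rewrite divr_gt0 ?mulr_gt0 ?subr_gt0.
have eE : e * (rnorm m + K) = (rnorm m - K) * rnorm m / 2.
  by rewrite /e; field; rewrite gt_eqF.
have h1 := rdot_le m (m - (a + b)).
have h2 := rdot_le (m + n) b.
have h3 : rdot m (a + b) = rdot (m + n) b.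
  by rewrite rdotDl rdotDr /rdot (Ma _ Mm) (Nb _ Nn) /= addr0 add0r.
have h4 : rnorm (m + n) * rnorm b <= K * rnorm (a + b).
  by rewrite /K mulrAC mulrC ler_wpM2r ?rnorm_ge0 ?hb.
have h5 : rnorm (a + b) <= rnorm m + rnorm (m - (a + b)).
  rewrite (rnorm_sub m); apply: le_trans (ler_rnormD _ _).
  by rewrite [X in _ <= rnorm X]addrC subrK.
have h6 : K * rnorm (a + b) <= K * (rnorm m + e).
  by rewrite ler_wpM2l // (le_trans h5) // lerD2l ltW.
have h7 : rnorm m * rnorm (m - (a + b)) <= rnorm m * e.
  by rewrite ler_wpM2l ?rnorm_ge0 // ltW.
have h8 := rdotxx m.
have h9 : 0 < (rnorm m - K) * rnorm m by rewrite mulr_gt0 ?subr_gt0.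
have := rdotBr m m (a + b).
by rewrite h3; nra.
Qed.

(** * Bounded idempotents: ranges, null spaces, complements and order *)

Lemma bounded_idem_of (f : H -> H) : linear f ->
  (exists C, forall x, rnorm (f x) <= C * rnorm x) ->
  (forall x, f (f x) = f x) -> exists E : 'B(H)^Id, E =1 f.
Proof.
move=> lf [C fC] ff.
pose g : {linear H -> H} := HB.pack f (GRing.isLinear.Build _ _ _ _ f lf).
have bg : bounded_near g (nbhs (0 : H)).
  apply/linear_boundedP; exists (C%:C)%C.
  split=> [|r Cr x]; first by rewrite complex_real.
  rewrite (le_trans _ (ler_wpM2r _ (ltW Cr))) // !rnormE -rmorphM lecR.
  exact: fC.
by exists (@BoundedIdem R H g bg (funext ff)).
Qed.

Section Idempotents.
Implicit Types P Q E F : 'B(H)^Id.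

Lemma bidem_bound P : exists C, forall x, rnorm (P x) <= C * rnorm x.
Proof.
have /linear_boundedP[M [Mr hM]] := bidem_bounded P.
(* The library bound holds only for constants strictly above [M], hence the [+ 1]. *)
exists (complex.Re M + 1) => x; rewrite -lecR rmorphM /= -!rnormE.
apply: hM; rewrite -{1}(RRe_real Mr) ltcR.
by rewrite ltrDl.
Qed.

Lemma bidemK P x : P (P x) = P x.
Proof. exact: (congr1 (fun f => f x) (bidem_idem P)). Qed.

Lemma range_bidemP P x : range P x <-> P x = x.
Proof. by split=> [[y _ <-]|<-]; [exact: bidemK|exists x]. Qed.

Lemma subspace_nullspace P : subspace (nullspace P).
Proof.
split=> [|a x y Px Py]; first exact: linear0.
by rewrite /nullspace /= linearP Px Py scaler0 addr0.
Qed.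

Lemma subspace_range P : subspace (range P).
Proof.
split=> [|a x y /range_bidemP Px /range_bidemP Py].
  by apply/range_bidemP; exact: linear0.
by apply/range_bidemP; rewrite linearP Px Py.
Qed.

Lemma closed_nullspace P : closed (nullspace P).
Proof.
move=> x /closure_rnormP Px; have [C PC] := bidem_bound P.
apply/rnorm_eq0/eqP; rewrite eq_le rnorm_ge0 andbT.
apply/ler_addgt0Pl => e e0; rewrite addr0.
have C1 : 0 < `|C| + 1 by rewrite ltr_wpDl.
have [|y Py xy] := Px (e / (`|C| + 1)); first by rewrite divr_gt0.
rewrite -[P x]subr0 -Py -linearB (le_trans (PC _)) //.
move: xy; rewrite ltr_pdivlMr // mulrC => /ltW; apply: le_trans.
by rewrite ler_wpM2r ?rnorm_ge0 // (le_trans (ler_norm _)) // lerDl.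
Qed.

Lemma bidem_compl_exists P : exists E, forall x, E x = x - P x.
Proof.
apply: bounded_idem_of.
- by move=> a x y; rewrite linearP scalerBr opprD addrACA.
- have [C PC] := bidem_bound P; exists (1 + C) => x.
  by rewrite (le_trans (ler_rnormD _ _)) // rnormN mulrDl mul1r lerD2l.
- by move=> x; rewrite linearB bidemK subrr subr0.
Qed.

Definition bidem_compl P : 'B(H)^Id := projT1 (cid (bidem_compl_exists P)).

Lemma bidem_complE P x : bidem_compl P x = x - P x.
Proof. exact: projT2 (cid (bidem_compl_exists P)) x. Qed.

Lemma nullspace_compl P : nullspace (bidem_compl P) = range P.
Proof.
apply/seteqP; split=> x; rewrite /nullspace /= bidem_complE.
  by move/eqP; rewrite subr_eq0 eq_sym => /eqP/range_bidemP.
by move/range_bidemP=> ->; rewrite subrr.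
Qed.

Lemma bidem_complK : involutive bidem_compl.
Proof. by move=> P; apply: bidemP => x; rewrite !bidem_complE subKr. Qed.

Lemma range_compl P : range (bidem_compl P) = nullspace P.
Proof. by rewrite -nullspace_compl bidem_complK. Qed.

Lemma closed_range P : closed (range P).
Proof. by rewrite -nullspace_compl; exact: closed_nullspace. Qed.

(** [E \o P = P] says that [E] fixes the range of [P]; [P \o E = P] says that [P] kills every
    [x - E x], and these vectors fill the null space of [E]. *)
Lemma bidem_leP P E : reflect
  (range P `<=` range E /\ nullspace E `<=` nullspace P) (P <= E)%O.
Proof.
apply: (iffP (asboolP _)) => -[h1 h2].
  split=> x; first by move=> [y _ <-]; rewrite -h2; exists (P y).
  by rewrite /nullspace /= -(congr1 (@^~ x) h1) /= => ->; exact: linear0.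
split; apply/funext => x /=; last by apply/range_bidemP/h1; exists x.
apply/eqP; rewrite -subr_eq0 -linearB; apply/eqP/h2.
by rewrite /nullspace /= linearB bidemK subrr.
Qed.

Lemma bidem_compl_le P Q : (bidem_compl P <= bidem_compl Q)%O = (Q <= P)%O.
Proof.
by apply/bidem_leP/bidem_leP; rewrite !range_compl !nullspace_compl => -[].
Qed.

Lemma direct_decompC (M N : set H) : direct_decomp M N -> direct_decomp N M.
Proof.
case=> MN0 MNT; split; first by rewrite setIC.
apply/seteqP; split=> // x _; have : sumset M N x by rewrite MNT.
by case=> m Mm [n Nn <-]; exists n => //; exists m => //; rewrite addrC.
Qed.

Lemma direct_decomp_bidem P : direct_decomp (nullspace P) (range P).
Proof.
split.
  apply/seteqP; split=> x /=; first by move=> [Px /range_bidemP <-].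
  by move=> ->; split; [exact: (subspace_nullspace P).1|exact: (subspace_range P).1].
apply/seteqP; split=> // x _; exists (x - P x).
  by rewrite /nullspace /= linearB bidemK subrr.
by exists (P x); [exists x|rewrite subrK].
Qed.

(** Directness makes the [M]-component of a vector unique, hence linear and idempotent;
    [oblique_bound] makes it bounded. *)
Lemma oblique_projection (M N : set H) : subspace M -> subspace N ->
  closed M -> closed N -> direct_decomp M N ->
  exists E, idem_onto_along E M N.
Proof.
move=> sM sN cM cN MN; have [MN0 MNT] := MN.
have [C hC] := oblique_bound sM sN cM cN MN.
have /choice[f fP] x : exists m, M m /\ N (x - m).
  have : sumset M N x by rewrite MNT.
  by case=> m Mm [n Nn <-]; exists m; rewrite addrAC subrr add0r.
have fU x m : M m -> N (x - m) -> f x = m.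
  move=> Mm Nm; have [Mf Nf] := fP x.
  have : (M `&` N) (f x - m).
    split; first exact: subspaceB.
    have -> : f x - m = (x - m) - (x - f x) by rewrite opprB addrCA addrAC subrr add0r.
    exact: subspaceB.
  by rewrite MN0 => /eqP; rewrite subr_eq0 => /eqP.
have fM m : M m -> f m = m by move=> Mm; apply: fU => //; rewrite subrr; exact: sN.1.
have [||x|E Ef] := @bounded_idem_of f.
- move=> a x y; have [Mx Nx] := fP x; have [My Ny] := fP y.
  apply: fU; first exact: sM.2.
  by rewrite opprD addrACA -scalerBr; exact: sN.2.
- exists C => x; have [Mx Nx] := fP x.
  by have := hC _ _ Mx Nx; rewrite addrC subrK.
- by apply: fM; have [] := fP x.
exists E; split; apply/seteqP; split=> x.
- by move=> [y _ <-]; rewrite Ef; have [] := fP y.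
- by move=> Mx; apply/range_bidemP; rewrite Ef fM.
- by rewrite /nullspace /= Ef => fx; have [_] := fP x; rewrite fx subr0.
- by move=> Nx; rewrite /nullspace /= Ef; apply: fU; [exact: sM.1|rewrite subr0].
Qed.

(** * Upper bounds and suprema of two idempotents *)

Lemma ubound_bidemP P Q F : ubound [set P; Q] F <->
  sumset (range P) (range Q) `<=` range F /\
  nullspace F `<=` nullspace P `&` nullspace Q.
Proof.
split=> [ubF|[SF NF]].
  have /bidem_leP[PF FP] : (P <= F)%O by apply: ubF; left.
  have /bidem_leP[QF FQ] : (Q <= F)%O by apply: ubF; right.
  split; last by move=> x Fx; split; [exact: FP|exact: FQ].
  move=> _ [x Px [y Qy <-]].
  by apply: subspaceD (PF _ Px) (QF _ Qy); exact: subspace_range.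
move=> G [->|->]; apply/bidem_leP; split=> x.
- move=> Px; apply: SF; exists x => //.
  by exists 0; [exact: (subspace_range Q).1|rewrite addr0].
- by case/NF.
- move=> Qx; apply: SF; exists 0; first exact: (subspace_range P).1.
  by exists x => //; rewrite add0r.
- by case/NF.
Qed.

Lemma subspace_nullI P Q : subspace (nullspace P `&` nullspace Q).
Proof.
have [P0 PD] := subspace_nullspace P; have [Q0 QD] := subspace_nullspace Q.
by split=> // a x y [Px Qx] [Py Qy]; split; [exact: PD|exact: QD].
Qed.

(** This is the idempotent along the line of [y] onto the vectors orthogonal to [v]. It provides the
    upper bounds against which minimality of a supremum is tested. *)
Lemma rank_one_compl y v : inner y v != 0 ->
  exists F, forall x, F x = x - (inner x v / inner y v) *: y.
Proof.
move=> yv; apply: bounded_idem_of.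
- move=> a x z; rewrite innerDl innerZl mulrDl scalerDl opprD -mulrA -scalerA.
  by rewrite addrACA -scalerBr.
- have [C hC] := inner_bound v.
  exists (1 + C * rnorm ((inner y v)^-1 *: y)) => x.
  rewrite (le_trans (ler_rnormD _ _)) // rnormN mulrDl mul1r lerD2l.
  by rewrite -scalerA rnormZ mulrAC ler_wpM2r ?rnorm_ge0.
- by move=> x; rewrite innerBl innerZl divfK // subrr mul0r scale0r subr0.
Qed.

Lemma supremum_onto_along P Q E : supremums [set P; Q] E -> E <> bidem1 H ->
  idem_onto_along E (closure (sumset (range P) (range Q)))
                    (nullspace P `&` nullspace Q).
Proof.
set S := sumset _ _; set N := _ `&` _ => -[/ubound_bidemP[SE EN] leE] E1.
have sS : subspace S by apply: subspace_sumset; exact: subspace_range.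
have sN : subspace N by exact: subspace_nullI.
(* Minimality puts [E] below the rank-one complement [F]: [y] is killed by [F], hence by [E], and
   the range of [E] lies in that of [F], which is orthogonal to [v]. *)
have key y v : N y -> orth S v -> inner y v != 0 ->
    nullspace E y /\ orth (range E) v.
  move=> Ny Sv yv; have [F FE] := rank_one_compl yv.
  have y0 : y != 0 by apply: contraNneq yv => ->; rewrite inner0l.
  have /leE/bidem_leP[EF FE'] : ubound [set P; Q] F.
    apply/ubound_bidemP; split=> x.
      by move=> Sx; apply/range_bidemP; rewrite FE Sv // mul0r scale0r subr0.
    rewrite /nullspace /= FE => /eqP; rewrite subr_eq0 => /eqP ->.
    exact: subspaceZ sN Ny.
  split; first by apply: FE'; rewrite /nullspace /= FE divff // scale1r subrr.
  move=> x /EF/range_bidemP; rewrite FE => /eqP.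
  rewrite -subr_eq0 addrAC subrr add0r oppr_eq0 scaler_eq0 (negPf y0) orbF.
  by rewrite mulf_eq0 invr_eq0 (negPf yv) orbF => /eqP.
have [y0 Ey0 y0n] : exists2 y, nullspace E y & y <> 0.
  apply: contrapT => h; apply: E1; apply: bidemP => x /=.
  apply: contrapT => Ex; apply: h; exists (x - E x).
    by rewrite /nullspace /= linearB bidemK subrr.
  by move/eqP; rewrite subr_eq0 eq_sym => /eqP.
(* Otherwise [y0] would lie in the closed range of [E] as well as in its null space, and so be
   zero. *)
have [v0 Ev0 y0v0] : exists2 v, orth (range E) v & inner y0 v != 0.
  apply: contrapT => h; apply: y0n.
  have /closed_range/range_bidemP <- : closure (range E) y0.
    apply: closure_double_orth => [|v Ev]; first exact: subspace_range.
    by apply: contrapT => /eqP yv; apply: h; exists v.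
  exact: Ey0.
have Sv0 : orth S v0 by move=> x /SE; exact: Ev0.
split; apply/seteqP; split.
- move=> x Ex; apply: closure_double_orth => // v Sv.
  have [yv|yv] := eqVneq (inner y0 v) 0; last first.
    by have [_] := key _ _ (EN _ Ey0) Sv yv; apply.
  (* Adding [v0] makes the pairing with [y0] nonzero and changes no inner product with the range of
     [E]. *)
  have [||_ /(_ _ Ex)] := key y0 (v + v0) (EN _ Ey0).
  - by apply: subspaceD Sv Sv0; exact: subspace_orth.
  - by rewrite innerDr yv add0r.
  - by rewrite innerDr (Ev0 _ Ex) addr0.
- by move=> x /(closureS SE)/closed_range.
- exact: EN.
- move=> y Ny; have [yv|yv] := eqVneq (inner y v0) 0; last first.
    by have [] := key _ _ Ny Sv0 yv.
  (* Dually, [y0] makes the pairing with [v0] nonzero and is subtracted again inside the null space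
     of [E]. *)
  have [||Ey _] := key (y + y0) v0 _ Sv0.
  - exact: subspaceD sN Ny (EN _ Ey0).
  - by rewrite innerDl yv add0r.
  - by rewrite -(addrK y0 y); apply: subspaceB Ey Ey0; exact: subspace_nullspace.
Qed.

(** The oblique projection is least because the range of any upper bound is closed and so contains
    [closure S], not only [S]. *)
Lemma supremum_exists P Q :
  nullspace P `&` nullspace Q <> [set 0] ->
  direct_decomp (nullspace P `&` nullspace Q)
                (closure (sumset (range P) (range Q))) ->
  exists2 E, supremums [set P; Q] E & E <> bidem1 H.
Proof.
set S := sumset _ _; set N := _ `&` _ => N0 dec.
have sS : subspace S by apply: subspace_sumset; exact: subspace_range.
have [||||E [rE nE]] := @oblique_projection (closure S) N _ _ _ _ (direct_decompC dec).
- exact: subspace_closure.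
- exact: subspace_nullI.
- exact: closed_closure.
- by apply: closedI; exact: closed_nullspace.
exists E.
  split; first by apply/ubound_bidemP; rewrite rE nE; split=> //; exact: subset_closure.
  move=> F /ubound_bidemP[SF FN]; apply/bidem_leP; rewrite rE nE; split=> //.
  by move=> x /(closureS SF)/closed_range.
by move=> E1; apply: N0; rewrite -nE E1.
Qed.

Lemma supremum_iff P Q :
  (exists2 E, supremums [set P; Q] E & E <> bidem1 H) <->
  (nullspace P `&` nullspace Q <> [set 0] /\
   direct_decomp (nullspace P `&` nullspace Q)
                 (closure (sumset (range P) (range Q)))).
Proof.
split=> [[E supE E1]|[N0 dec]]; last exact: supremum_exists.
(* The null space and range of [E] are themselves the two summands. *)
have [<- <-] := supremum_onto_along supE E1.
split; last exact: direct_decomp_bidem.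
move=> N0; apply: E1; apply: bidemP => x /=.
have : nullspace E (x - E x) by rewrite /nullspace /= linearB bidemK subrr.
by rewrite N0 => /eqP; rewrite subr_eq0 eq_sym => /eqP.
Qed.

(** * Infima by complementation *)

(** [bidem_compl] is an order-reversing involution, so it exchanges lower and upper bounds. *)
Lemma infimums_compl P Q E :
  infimums [set P; Q] E <-> supremums [set bidem_compl P; bidem_compl Q] (bidem_compl E).
Proof.
split=> -[h1 h2]; split.
- by move=> F [->|->]; rewrite bidem_compl_le; apply: h1; [left|right].
- move=> F hF; rewrite -[F]bidem_complK bidem_compl_le; apply: h2.
  by move=> G [->|->]; rewrite -bidem_compl_le bidem_complK; apply: hF; [left|right].
- by move=> F [->|->]; rewrite -bidem_compl_le; apply: h1; [left|right].
- move=> F hF; rewrite -bidem_compl_le; apply: h2.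
  by move=> G [->|->]; rewrite bidem_compl_le; apply: hF; [left|right].
Qed.

Lemma bidem_compl0 : bidem_compl (bidem0 H) = bidem1 H.
Proof. by apply: bidemP => x; rewrite bidem_complE subr0. Qed.

Lemma bidem_compl_neq1 E : bidem_compl E <> bidem1 H <-> E <> bidem0 H.
Proof.
rewrite -bidem_compl0; split=> h e; apply: h; first by rewrite e.
exact: (can_inj bidem_complK).
Qed.

End Idempotents.

End HilbertGeometry.

Theorem theorem2p9 (R : realType) (H : hilbertType R) (sepH : separable H)
    (P Q : 'B(H)^Id) :
  (((exists2 E : 'B(H)^Id, supremums [set P; Q] E & E <> bidem1 H) <->
    (nullspace P `&` nullspace Q <> [set 0] /\
     direct_decomp (nullspace P `&` nullspace Q)
                   (closure (sumset (range P) (range Q))))) /\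
   (forall E : 'B(H)^Id, supremums [set P; Q] E -> E <> bidem1 H ->
     idem_onto_along E (closure (sumset (range P) (range Q)))
                       (nullspace P `&` nullspace Q)))
  /\
  (((exists2 E : 'B(H)^Id, infimums [set P; Q] E & E <> bidem0 H) <->
    (range P `&` range Q <> [set 0] /\
     direct_decomp (range P `&` range Q)
                   (closure (sumset (nullspace P) (nullspace Q))))) /\
   (forall E : 'B(H)^Id, infimums [set P; Q] E -> E <> bidem0 H ->
     idem_onto_along E (range P `&` range Q)
                       (closure (sumset (nullspace P) (nullspace Q))))).
Proof.
split; first by split; [exact: supremum_iff|move=> E; exact: supremum_onto_along].
(* Every range becomes a null space of a complement and conversely, so the second part reads as the
   first one for [bidem_compl P] and [bidem_compl Q]. *)
rewrite -(nullspace_compl P) -(nullspace_compl Q) -(range_compl P) -(range_compl Q).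
split.
  apply: iff_trans (supremum_iff _ _); split=> [[E infE E0]|[E supE E1]].
    exists (bidem_compl E); first exact/infimums_compl.
    exact/bidem_compl_neq1.
  exists (bidem_compl E); first by apply/infimums_compl; rewrite bidem_complK.
  by apply/bidem_compl_neq1; rewrite bidem_complK.
move=> E /infimums_compl supE /bidem_compl_neq1 E1.
have [rE nE] := supremum_onto_along supE E1.
by split; [rewrite -nE nullspace_compl|rewrite -rE range_compl].
Qed.
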